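(* Let $n\ge2$. The set $\mathcal{M}_{NA}(\mathbb{R}^n)$ of negatively associated probability measures on $\mathbb{R}^n$, as a subset of the space $\mathcal{M}(\mathbb{R}^n)$ of all Borel probability measures on $\mathbb{R}^n$, has empty interior with respect to both the total variation topology and the weak topology.
   Context: A function $f:\mathbb{R}^m\to\mathbb{R}$ is non-decreasing if $f(x)\ge f(y)$ whenever $x\ge y$ coordinatewise. For $I\subset\{1,\dots,n\}$, $x_I\in\mathbb{R}^{|I|}$ is the restriction of $x$ to the coordinates in $I$. A probability measure $\mu$ on $\mathbb{R}^n$ is negatively associated (NA) if for all disjoint $I,J\subset\{1,\dots,n\}$ and all non-decreasing integrable $f:\mathbb{R}^{|I|}\to\mathbb{R}$, $g:\mathbb{R}^{|J|}\to\mathbb{R}$, $$\int f(x_I)g(x_J)\,d\mu(x)\le\int f(x_I)\,d\mu(x)\int g(x_J)\,d\mu(x).$$ The total variation topology is induced by $\|\mu-\nu\|_{TV}=\sup_{|f|\le1}\left|\int f\,d\mu-\int f\,d\nu\right|$ (supremum over Borel $f$ with $|f|\le1$). The weak topology is the weakest topology making $\mu\mapsto\int f\,d\mu$ continuous for every continuous $f:\mathbb{R}^n\to\mathbb{R}$ vanishing at infinity; on probability measures it is the topology of convergence in distribution. *)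

(* Defs.v *)
From HB Require Import structures.
From mathcomp Require Import all_boot all_order all_algebra.
From mathcomp Require Import all_classical all_reals all_analysis.

Set Implicit Arguments.
Unset Strict Implicit.
Unset Printing Implicit Defensive.

Import Order.TTheory GRing.Theory Num.Theory.
Import numFieldNormedType.Exports.

Local Open Scope classical_set_scope.
Local Open Scope ring_scope.

Definition borel_rV (R : realType) (n : nat) :
    measurableType (@open 'rV[R]_n).-sigma :=
  g_sigma_algebraType (@open 'rV[R]_n).

Notation borel_probability R n := (probability (borel_rV R n) R).

Definition coord_nondecreasing (R : realType) (m : nat) (f : 'rV[R]_m -> R) :=
  forall x y : 'rV[R]_m, (forall i, y ord0 i <= x ord0 i) -> f y <= f x.

Definition restr (R : realType) (n : nat) (I : {set 'I_n}) (x : 'rV[R]_n) :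
    'rV[R]_#|I| :=
  \row_(j < #|I|) x ord0 (enum_val j).

(* Integrals take values in \bar R, so integrability of the product need not
   be assumed. The condition for bounded f and g already forces the positive
   part of the product to be integrable, by truncation, so that the left-hand
   side is never an indeterminate +oo - +oo. *)
Definition negatively_associated (R : realType) (n : nat)
    (mu : borel_probability R n) :=
  forall (I J : {set 'I_n}), disjoint (mem I) (mem J) ->
  forall (f : 'rV[R]_#|I| -> R) (g : 'rV[R]_#|J| -> R),
    coord_nondecreasing f -> coord_nondecreasing g ->
    mu.-integrable [set: borel_rV R n] (fun x => (f (restr I x))%:E) ->
    mu.-integrable [set: borel_rV R n] (fun x => (g (restr J x))%:E) ->
    (\int[mu]_x (f (restr I x) * g (restr J x))%:E <=
     (\int[mu]_x (f (restr I x))%:E) * (\int[mu]_x (g (restr J x))%:E))%E.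

Definition borel_unit_ball (R : realType) (n : nat) :
    set (borel_rV R n -> R) :=
  [set f : borel_rV R n -> R | measurable_fun setT f /\ forall x, `|f x| <= 1].

Definition tv_dist (R : realType) (n : nat) (mu nu : borel_probability R n) : R :=
  sup [set `|\int[mu]_x f x - \int[nu]_x f x| | f in @borel_unit_ball R n].

Section tv_metric.
Variables (R : realType) (n : nat).
Implicit Types (mu nu : borel_probability R n) (f : borel_rV R n -> R).

Lemma borel_unit_ball_integrable mu f : borel_unit_ball f ->
  mu.-integrable setT (EFin \o f).
Proof.
move=> [mf f1]; apply: measurable_bounded_integrable => //.
  by rewrite /= probability_setT ltry.
exists 1; split => // M M1 x _ /=; exact: le_trans (f1 x) (ltW M1).
Qed.

Lemma borel_unit_ball_Rintegral mu f : borel_unit_ball f ->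
  `|\int[mu]_x f x| <= 1.
Proof.
move=> Hf; apply: le_trans (le_normr_Rintegral _ _) _ => //.
  exact: borel_unit_ball_integrable.
have [mf f1] := Hf.
have -> : 1 = \int[mu]_x (cst 1 x) :> R.
  by rewrite Rintegral_cst//= probability_setT mul1r.
apply: le_Rintegral => //.
  exact/integrable_norm/borel_unit_ball_integrable.
apply: borel_unit_ball_integrable; split => // x.
by rewrite normr1.
Qed.

Let D mu nu :=
  [set `|\int[mu]_x f x - \int[nu]_x f x| | f in @borel_unit_ball R n].

Lemma tv_has_sup mu nu : has_sup (D mu nu).
Proof.
split.
  exists `|\int[mu]_x (cst 0 x) - \int[nu]_x (cst 0 x)|, (cst 0) => //.
  by split => // x; rewrite normr0.
exists 2 => _ [f Hf <-]; apply: le_trans (ler_normB _ _) _.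
by rewrite -[2]/(1 + 1); apply: lerD; exact: borel_unit_ball_Rintegral.
Qed.

Lemma tv_dist_ub mu nu f : borel_unit_ball f ->
  `|\int[mu]_x f x - \int[nu]_x f x| <= tv_dist mu nu.
Proof.
by move=> Hf; apply: ub_le_sup; [have [] := tv_has_sup mu nu|exists f].
Qed.

Lemma tv_dist_le mu nu e :
  (forall f, borel_unit_ball f -> `|\int[mu]_x f x - \int[nu]_x f x| <= e) ->
  tv_dist mu nu <= e.
Proof.
move=> He; apply: ge_sup; first by have [] := tv_has_sup mu nu.
by move=> _ [f Hf <-]; exact: He.
Qed.

Lemma tv_distxx mu : tv_dist mu mu = 0.
Proof.
apply/eqP; rewrite eq_le; apply/andP; split.
  by apply: tv_dist_le => f _; rewrite subrr normr0.
apply: le_trans (tv_dist_ub mu mu (f := cst 0) _); first exact: normr_ge0.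
by split => // x; rewrite normr0.
Qed.

Lemma tv_dist_sym mu nu : tv_dist mu nu = tv_dist nu mu.
Proof.
by rewrite /tv_dist; congr sup; apply: eq_imagel => f _; rewrite distrC.
Qed.

Lemma tv_dist_triangle nu mu la : tv_dist mu la <= tv_dist mu nu + tv_dist nu la.
Proof.
apply: tv_dist_le => f Hf; apply: le_trans (ler_distD (\int[nu]_x f x) _ _) _.
by apply: lerD; exact: tv_dist_ub.
Qed.

Definition tv_ball mu (e : R) : set (borel_probability R n) :=
  [set nu | tv_dist mu nu < e].

Lemma tv_ball_center mu (e : R) : 0 < e -> tv_ball mu e mu.
Proof. by move=> e0; rewrite /tv_ball/= tv_distxx. Qed.

Lemma tv_ball_sym mu nu (e : R) : tv_ball mu e nu -> tv_ball nu e mu.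
Proof. by rewrite /tv_ball/= tv_dist_sym. Qed.

Lemma tv_ball_triangle mu nu la (e1 e2 : R) :
  tv_ball mu e1 nu -> tv_ball nu e2 la -> tv_ball mu (e1 + e2) la.
Proof.
rewrite /tv_ball/= => h1 h2; apply: le_lt_trans (tv_dist_triangle nu _ _) _.
exact: ltrD.
Qed.

End tv_metric.

(* Only a pseudometric: terms of type probability are functions on all sets, so
   two of them may agree on every Borel set without being equal. Such terms are
   indistinguishable in both topologies below and for integration. *)
Definition tv_probability (R : realType) (n : nat) : Type :=
  borel_probability R n.

HB.instance Definition _ (R : realType) (n : nat) :=
  Choice.on (tv_probability R n).
HB.instance Definition _ (R : realType) (n : nat) :=
  hasNbhs.Build (tv_probability R n) (nbhs_ (entourage_ (@tv_ball R n))).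
HB.instance Definition _ (R : realType) (n : nat) :=
  @Nbhs_isPseudoMetric.Build R (tv_probability R n)
    (entourage_ (@tv_ball R n)) erefl (@tv_ball R n) (@tv_ball_center R n)
    (@tv_ball_sym R n) (@tv_ball_triangle R n) erefl.

Definition vanishes_at_infinity (R : realType) (n : nat) (f : 'rV[R]_n -> R) :=
  forall e : R, 0 < e ->
    exists2 K : set 'rV[R]_n, compact K & forall x, ~ K x -> `|f x| < e.

Definition C0 (R : realType) (n : nat) : Type :=
  {f : 'rV[R]_n -> R | continuous f /\ vanishes_at_infinity f}.

Definition integral_against (R : realType) (n : nat) (f : C0 R n)
    (mu : borel_probability R n) : R :=
  Rintegral mu [set: borel_rV R n] (sval f).

Definition weak_probability (R : realType) (n : nat) : Type :=
  sup_topology (fun f : C0 R n =>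
    Topological.class (initial_topology (@integral_against R n f))).

HB.instance Definition _ (R : realType) (n : nat) :=
  Topological.on (weak_probability R n).

(* Main.v *)
From HB Require Import structures.
Require Import Defs.
From mathcomp Require Import all_boot all_order all_algebra.
From mathcomp Require Import all_classical all_reals all_analysis.
From mathcomp Require Import measurable_realfun ring lra.

Import Order.TTheory GRing.Theory Num.Theory.
Import numFieldNormedType.Exports.

(** Non-association is dense because it can be forced by an arbitrarily small
    amount of mass.  Given a probability measure mu and a small weight w, the
    mixture nu = (1 - w) mu + w delta_a is within 2 w of mu in total variation
    ([tv_dist_contaminated]).  Put the atom a = (r + 1, ..., r + 1) far out on
    the diagonal.  For two coordinates i != j, both nu {x_i > r} and
    nu {x_j > r} are at most w plus a tail of mu, hence less than 2 w for r
    large, while the joint event {x_i > r, x_j > r} contains the atom and so has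
    mass at least w.  Negative association, applied to the increasing
    indicators of these events ([negatively_associated_tail]), would give
    w <= (2 w)^2, which fails for w < 1/4
    ([contaminated_not_negatively_associated]).  So every ball of the total
    variation topology contains a measure that is not negatively associated.

    The weak topology is coarser: integration against a function vanishing at
    infinity, which is bounded, is continuous in total variation
    ([tv_weak_continuous]).  A weak interior point would thus be an interior
    point in total variation. *)

Local Open Scope classical_set_scope.
Local Open Scope ring_scope.

(** Huber's contamination of P by a point mass: an observation drawn from P is
    replaced with a with probability w. *)
Definition contaminated {d : measure_display} {T : measurableType d}
    {R : realType} (P : probability T R) (a : T) (w : {i01 R}) :
    set T -> \bar R :=
  measure_add (mscale (1 - w%:inum)%:nng P) (mscale (w%:inum)%:nng (\d_a)).

HB.instance Definition _ (d : measure_display) (T : measurableType d)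
    (R : realType) (P : probability T R) (a : T) (w : {i01 R}) :=
  Measure.on (contaminated P a w).

Lemma contaminatedE {d : measure_display} {T : measurableType d}
    {R : realType} (P : probability T R) (a : T) (w : {i01 R}) (A : set T) :
  contaminated P a w A = ((1 - w%:inum)%:E * P A + (w%:inum)%:E * \d_a A)%E.
Proof. by rewrite /contaminated measure_addE. Qed.

Lemma contaminated_setT {d : measure_display} {T : measurableType d}
    {R : realType} (P : probability T R) (a : T) (w : {i01 R}) :
  contaminated P a w setT = 1%E.
Proof.
by rewrite contaminatedE probability_setT diracT !mule1 -EFinD subrK.
Qed.

HB.instance Definition _ (d : measure_display) (T : measurableType d)
    (R : realType) (P : probability T R) (a : T) (w : {i01 R}) :=
  Measure_isProbability.Build d T R (contaminated P a w)
    (contaminated_setT P a w).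

Lemma ge0_integral_contaminated {d : measure_display} {T : measurableType d}
    {R : realType} (P : probability T R) (a : T) (w : {i01 R})
    (f : T -> \bar R) :
  measurable_fun setT f -> (forall x, 0 <= f x)%E ->
  (\int[contaminated P a w]_x f x =
   (1 - w%:inum)%:E * \int[P]_x f x + (w%:inum)%:E * f a)%E.
Proof.
move=> mf f0; rewrite /contaminated ge0_integral_measure_add//.
by rewrite !ge0_integral_mscale// integral_dirac// diracT mul1e.
Qed.

(** Follows from the nonnegative case applied to the positive and negative
    parts, whose integrals are finite. *)
Lemma Rintegral_contaminated {d : measure_display} {T : measurableType d}
    {R : realType} (P : probability T R) (a : T) (w : {i01 R}) (f : T -> R) :
  P.-integrable setT (EFin \o f) ->
  \int[contaminated P a w]_x f x =
  (1 - w%:inum) * \int[P]_x f x + w%:inum * f a.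
Proof.
move=> fi.
have mf : measurable_fun setT (EFin \o f) by exact: measurable_int fi.
have p_fin := integrable_pos_fin_num measurableT fi.
have n_fin := integrable_neg_fin_num measurableT fi.
have mfp : measurable_fun setT ((EFin \o f)^\+)%E by exact: measurable_funepos.
have mfn : measurable_fun setT ((EFin \o f)^\-)%E by exact: measurable_funeneg.
rewrite /Rintegral integralE [in RHS]integralE.
rewrite !ge0_integral_contaminated//.
rewrite -(fineK p_fin) -(fineK n_fin) funerpos funerneg /=.
have fa : f a = f^\+ a - f^\- a by rewrite -[in LHS](funrposBneg f).
by rewrite fa; ring.
Qed.

Lemma tv_dist_contaminated {R : realType} {n : nat} (mu : borel_probability R n)
    (a : borel_rV R n) (w : {i01 R}) :
  tv_dist mu (contaminated mu a w) <= w%:inum * 2.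
Proof.
apply: tv_dist_le => f f1.
rewrite Rintegral_contaminated; last exact: borel_unit_ball_integrable.
have -> : forall x y z : R, x - ((1 - z) * x + z * y) = z * (x - y).
  by move=> *; ring.
rewrite normrM ger0_norm// ler_wpM2l//.
apply: le_trans (ler_normB _ _) _; rewrite -[leRHS]/(1 + 1).
by apply: lerD; [exact: borel_unit_ball_Rintegral|case: f1].
Qed.

(** A named constant, so that it can carry the structure of a measurable
    function and be used as a random variable. *)
Definition coordinate {R : realType} {n : nat} (i : 'I_n) :
  borel_rV R n -> R := fun x => x ord0 i.

Lemma continuous_borel_measurable {R : realType} {n : nat} (f : 'rV[R]_n -> R) :
  continuous f -> measurable_fun [set: borel_rV R n] (f : borel_rV R n -> R).
Proof.
move=> cf; apply: (measurability _ (RGenOpens.measurableE R)) => //.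
move=> _ [_ [a [b ->]] <-]; rewrite setTI; apply: sub_sigma_algebra => /=.
by apply: open_comp; [move=> x _; exact: cf|exact: interval_open].
Qed.

Lemma measurable_coordinate {R : realType} {n : nat} (i : 'I_n) :
  measurable_fun [set: borel_rV R n] (coordinate i).
Proof. by apply: continuous_borel_measurable; exact: coord_continuous. Qed.

HB.instance Definition _ (R : realType) (n : nat) (i : 'I_n) :=
  isMeasurableFun.Build _ _ (borel_rV R n) R (coordinate i)
    (measurable_coordinate i).

Definition tail_event {R : realType} {n : nat} (i : 'I_n) (r : R) :
  set (borel_rV R n) := [set x | r < x ord0 i].

Lemma measurable_tail_event {R : realType} {n : nat} (i : 'I_n) (r : R) :
  measurable (tail_event i r : set (borel_rV R n)).
Proof.
have -> : tail_event i r = setT `&` coordinate i @^-1` `]r, +oo[.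
  by apply/seteqP; split=> x /=; rewrite in_itv/= andbT //; case.
exact: measurable_coordinate.
Qed.

(** The tail probabilities are the complementary distribution function of a
    coordinate seen as a random variable. *)
Lemma probability_tail_event_cvg0 {R : realType} {n : nat}
    (mu : borel_probability R n) (i : 'I_n) :
  mu (tail_event i r) @[r --> +oo%R] --> 0%E.
Proof.
pose X : {RV mu >-> R} := coordinate i.
have := cvg_ccdfy0 X; apply: cvg_trans; apply: near_eq_cvg.
near=> r; rewrite /ccdf /distribution /pushforward; congr (mu _).
by apply/seteqP; split=> x /=; rewrite in_itv/= andbT.
Unshelve. all: by end_near. Qed.

(** Negative association for the blocks {i} and {j} and the increasing functions
    1_{x_i > r} and 1_{x_j > r}, whose product is the indicator of the joint
    event. *)
Lemma negatively_associated_tail {R : realType} {n : nat}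
    (mu : borel_probability R n) (i j : 'I_n) (r : R) :
  i != j -> negatively_associated mu ->
  (mu (tail_event i r `&` tail_event j r) <=
   mu (tail_event i r) * mu (tail_event j r))%E.
Proof.
move=> ij na.
(* The restriction of x to the block {k} has the single entry x_k. *)
pose above (k : 'I_n) : set 'rV[R]_#|[set k]%SET| :=
  [set y | forall l, r < y ord0 l].
pose f (k : 'I_n) : 'rV[R]_#|[set k]%SET| -> R := \1_(above k).
have f_incr k : coord_nondecreasing (f k).
  move=> x y yx; rewrite /f !indicE ler_nat.
  case: (boolP (y \in above k)) => [/set_mem yr|//].
  by rewrite mem_set// => l; exact: lt_le_trans (yx l).
have fE k x : f k (restr [set k]%SET x) = \1_(tail_event k r) x.
  rewrite /f !indicE; congr (_%:R); congr nat_of_bool.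
  apply/idP/idP => /set_mem /= h; apply/mem_set => /=.
    have := h (enum_rank_in (set11 k) k).
    by rewrite mxE enum_rankK_in// set11.
  by move=> l; rewrite mxE; have /set1P -> := enum_valP l.
have mt k := measurable_tail_event k r.
have f_int k : mu.-integrable [set: borel_rV R n]
    (fun x => (f k (restr [set k]%SET x))%:E).
  under eq_fun do rewrite fE.
  by apply: integrable_indic => //; exact: fin_num_measure.
have dis : disjoint (mem [set i]%SET) (mem [set j]%SET).
  by rewrite disjoints1 inE.
have := na _ _ dis _ _ (f_incr i) (f_incr j) (f_int i) (f_int j).
under eq_integral do rewrite !fE
  -[_ * _]/((\1_(tail_event i r) \* \1_(tail_event j r)) _) -indicI.
under [X in (_ <= X * _)%E -> _]eq_integral do rewrite fE.
under [X in (_ <= _ * X)%E -> _]eq_integral do rewrite fE.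
by rewrite !integral_indic ?setIT//; exact: measurableI.
Qed.

(** The atom is (r + 1, ..., r + 1), with r so large that each tail event has
    mu-mass below w.  It makes the joint tail event weigh at least w, while each
    marginal one weighs less than 2 w; and 4 w^2 < w since w < 1/4. *)
Lemma contaminated_not_negatively_associated {R : realType} {n : nat}
    (mu : borel_probability R n) (i j : 'I_n) (w : {i01 R}) :
  i != j -> 0 < w%:inum < 4^-1 ->
  exists a : borel_rV R n, ~ negatively_associated (contaminated mu a w).
Proof.
move=> ij /andP[w0 w4].
have small k : \forall r \near +oo%R, (mu (tail_event k r) < (w%:inum)%:E)%E.
  apply: (probability_tail_event_cvg0 mu k [set y | (y < (w%:inum)%:E)%E]).
  by apply: open_ereal_lt'; rewrite lte_fin.
have [r [ri rj]] := filter_ex (filterI (small i) (small j)).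
exists (const_mx (r + 1)).
set a : borel_rV R n := const_mx _ => /(negatively_associated_tail _ _ _ r ij).
have ak k : tail_event k r a by rewrite /tail_event/= mxE ltrDl.
rewrite /= !contaminatedE !diracE.
rewrite in_setI !(mem_set (ak _)).
rewrite !mule1.
have fin k : mu (tail_event k r) \is a fin_num.
  by apply: fin_num_measure; exact: measurable_tail_event.
move: ri rj; rewrite -(fineK (fin i)) -(fineK (fin j)) !lte_fin.
have pi0 : 0 <= fine (mu (tail_event i r)) by exact: fine_ge0.
have pj0 : 0 <= fine (mu (tail_event j r)) by exact: fine_ge0.
move: (fine _) (fine _) pi0 pj0 => p q p0 q0 pw qw.
apply/negP; rewrite -ltNge.
apply: (@lt_le_trans _ _ (w%:inum)%:E).
  rewrite -!EFinM lte_fin; move: (w%:inum) w0 w4 pw qw => v v0 v4 pv qv.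
  have pv2 : (1 - v) * p + v < 2 * v by nra.
  have qv2 : (1 - v) * q + v < 2 * v by nra.
  apply: (@lt_trans _ _ ((2 * v) * (2 * v))); last by nra.
  by apply: ltr_pM => //; nra.
by rewrite leeDr// mule_ge0// lee_fin.
Qed.

(** Bounded by 1 off a compact set, and on it by continuity. *)
Lemma C0_bounded {R : realType} {n : nat} (f : C0 R n) :
  exists2 B : R, 0 < B & forall x, `|sval f x| <= B.
Proof.
case: f => f [cf vf] /=; have [K cK fK] := vf 1 ltr01.
have /compact_bounded[M [_ MB]] : compact (f @` K).
  by apply: continuous_compact => //; exact: continuous_subspaceT.
exists (Num.max 1 (M + 1)); first by rewrite lt_max ltr01.
move=> x; have [Kx|Kx] := pselect (K x); rewrite le_max.
  by rewrite (MB (M + 1)) ?orbT ?ltrDl//; exists x.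
by rewrite ltW ?fK.
Qed.

(** After division by a bound B of f, the function lies in the unit ball that
    defines the total variation distance, so integration against f is
    B-Lipschitz. *)
Lemma tv_continuous_integral_against {R : realType} {n : nat} (f : C0 R n) :
  continuous (integral_against f : tv_probability R n -> R).
Proof.
have [B B0 fB] := C0_bounded f.
pose g : borel_rV R n -> R := fun x => B^-1 * sval f x.
have g1 : borel_unit_ball g.
  have [cf _] := svalP f.
  split.
    by apply: measurable_funM => //; exact: continuous_borel_measurable.
  move=> x; rewrite /g normrM gtr0_norm ?invr_gt0//.
  by rewrite mulrC ler_pdivrMr ?mul1r.
have fg (mu : borel_probability R n) :
    integral_against f mu = B * \int[mu]_x g x.
  rewrite -RintegralZl//; last exact: borel_unit_ball_integrable.
  by apply: eq_Rintegral => x _; rewrite /g mulVKf// gt_eqF.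
move=> mu.
have nbhs_mu : Filter (nbhs (mu : tv_probability R n)) by exact: nbhs_filter.
apply/(@cvgrPdist_lt _ _ _ _ nbhs_mu) => e e0.
apply/(@nbhs_ballP _ (tv_probability R n)); exists (e / B) => /=.
  exact: divr_gt0.
move=> nu; rewrite /ball/= /tv_ball/= => munu.
rewrite !fg -mulrBr normrM gtr0_norm// mulrC -ltr_pdivlMr//.
by apply: le_lt_trans munu; exact: tv_dist_ub.
Qed.

(** The weak topology is initial for the integrals against functions vanishing
    at infinity, so it suffices that each of these be continuous. *)
Lemma tv_weak_continuous {R : realType} {n : nat} :
  continuous (id : tv_probability R n -> weak_probability R n).
Proof.
move=> mu.
have nbhs_mu : Filter (nbhs (mu : tv_probability R n)) by exact: nbhs_filter.
apply/(@cvg_sup _ _ _ _ _ (fmap_filter _ nbhs_mu)) => f.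
apply: (@continuous_comp_initial (borel_probability R n) (tv_probability R n) R
  (integral_against f) id _ mu).
exact: tv_continuous_integral_against.
Qed.

Theorem proposition4 (R : realType) (n : nat) (hn : (2 <= n)%N) :
  interior [set mu : tv_probability R n | negatively_associated mu] = set0 /\
  interior [set mu : weak_probability R n | negatively_associated mu] = set0.
Proof.
have tv :
    interior [set mu : tv_probability R n | negatively_associated mu] = set0.
  rewrite -subset0 => mu /nbhs_ballP[e /= e0 ball_na].
  (* t < 1/4 defeats negative association; the contamination moves mu by at
     most 2 t <= e / 2. *)
  pose t : R := Num.min 8^-1 (e / 4).
  have t0 : 0 < t by rewrite lt_min; apply/andP; split; lra.
  have [t8 te] : t <= 8^-1 /\ t <= e / 4 by split; rewrite ge_min lexx ?orbT.
  have t1 : t <= 1 by lra.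
  have t_small : 0 < t < 4^-1 by apply/andP; split=> //; lra.
  have [a not_na] := @contaminated_not_negatively_associated _ _ mu
    (Ordinal (ltnW hn)) (Ordinal hn) (Itv01 (ltW t0) t1) erefl t_small.
  apply: not_na; apply: ball_na; rewrite /ball/= /tv_ball/=.
  by apply: (le_lt_trans (tv_dist_contaminated _ _ _)) => /=; lra.
split => //; rewrite -subset0 -tv => mu.
exact: tv_weak_continuous.
Qed.
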